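(* Let $R$ and $S$ be commutative rings with non-zero identity, $f:R\to S$ a ring homomorphism, $J$ an ideal of $S$, and $I$ an ideal of $R$. (1) If $I\Join^f J$ is a $J$-ideal of $R\Join^f J$, then $I$ is a $J$-ideal of $R$. Moreover, the converse is true if $J\subseteq J(S)$. (2) If $I\Join^f J$ is a weakly $J$-ideal of $R\Join^f J$, then $I$ is a weakly $J$-ideal of $R$ and, for all $a,b\in R$ with $ab=0$, $a\notin J(R)$ and $b\notin I$, one has $f(a)j+f(b)i+ij=0$ for every $i,j\in J$. Moreover, the converse is true if $J\subseteq J(S)$.
   Context: $J(A)$ denotes the Jacobson radical of a ring $A$. The terms ''$J$-ideal'' and ''weakly $J$-ideal'' refer to the Jacobson radical, not to the ideal named $J$: a proper ideal $I$ of a ring $A$ is a $J$-ideal if whenever $a,b\in A$ with $ab\in I$ and $a\notin J(A)$, then $b\in I$; it is a weakly $J$-ideal if whenever $a,b\in A$ with $0\neq ab\in I$ and $a\notin J(A)$, then $b\in I$. The amalgamation of $R$ and $S$ along $J$ with respect to $f$ is the subring $R\Join^f J=\{(r,f(r)+j): r\in R, j\in J\}$ of $R\times S$. For an ideal $I$ of $R$, $I\Join^f J=\{(i,f(i)+j): i\in I, j\in J\}$, an ideal of $R\Join^f J$. *)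

(* Defs.v *)
From HB Require Import structures.
From mathcomp Require Import all_boot all_algebra.
From mathcomp Require Import ring.
From mathcomp Require Import boolp classical_sets.

Set Implicit Arguments.
Unset Strict Implicit.
Unset Printing Implicit Defensive.

Import GRing.Theory.
Local Open Scope classical_set_scope.
Local Open Scope ring_scope.

(* The whole ring is allowed as an ideal here, unlike in MathComp's [idealr].
   Closure under opposites follows from [idealM] with [-1]. *)
Record ideal (A : comNzRingType) := Ideal {
  ideal_set :> A -> Prop;
  ideal0 : ideal_set 0;
  idealD : forall x y, ideal_set x -> ideal_set y -> ideal_set (x + y);
  idealM : forall a x, ideal_set x -> ideal_set (a * x) }.

Definition is_proper (A : comNzRingType) (I : ideal A) : Prop :=
  (I : set A) <> setT.

Definition maximal_ideal (A : comNzRingType) (M : ideal A) : Prop :=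
  is_proper M /\
  forall N : ideal A, is_proper N -> M `<=` N -> (N : set A) = M.

Definition jacobson (A : comNzRingType) : set A :=
  \bigcap_(M in @maximal_ideal A) (M : set A).

Arguments jacobson : clear implicits.

Definition J_ideal (A : comNzRingType) (I : ideal A) : Prop :=
  is_proper I /\
  forall a b : A, I (a * b) -> ~ jacobson A a -> I b.

Definition weakly_J_ideal (A : comNzRingType) (I : ideal A) : Prop :=
  is_proper I /\
  forall a b : A, a * b != 0 -> I (a * b) -> ~ jacobson A a -> I b.

Section Amalgamation.
Variables (R S : comNzRingType) (f : {rmorphism R -> S}) (J : ideal S).

(* [amalg_set setT] is the carrier of the amalgamation of R and S along J, and
   [amalg_set I] is the set of its elements whose first component is in I. *)
Definition amalg_set (I : set R) : set (R * S)%type :=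
  [set (i, f i + j) | i in I & j in (J : set S)].

Lemma amalg_setP (I : set R) (x : R * S) :
  amalg_set I x <-> I x.1 /\ J (x.2 - f x.1).
Proof.
split=> [[i Ii [j Jj <-]]|]; first by rewrite /= addrAC subrr add0r.
by case: x => r s /= [Ir Js]; exists r => //; exists (s - f r); rewrite // addrC subrK.
Qed.

Definition amalg_pred : {pred R * S} := [pred x | x \in amalg_set setT].

Lemma amalg_subring_closed : subring_closed amalg_pred.
Proof.
have JN x : J x -> J (- x) by move=> Jx; rewrite -mulN1r; exact: idealM.
split=> [|x y|x y]; rewrite !inE !amalg_setP.
- by rewrite /= rmorph1 subrr; split=> //; exact: ideal0.
- move=> -[_ Jx] [_ Jy]; split=> //=.
  have -> : x.2 - y.2 - f (x.1 - y.1) = (x.2 - f x.1) + - (y.2 - f y.1).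
    by rewrite rmorphB; ring.
  by apply: idealD => //; exact: JN.
- move=> -[_ Jx] [_ Jy]; split=> //=.
  have -> : x.2 * y.2 - f (x.1 * y.1) =
      y.2 * (x.2 - f x.1) + f x.1 * (y.2 - f y.1).
    by rewrite rmorphM; ring.
  by apply: idealD; exact: idealM.
Qed.

HB.instance Definition _ :=
  GRing.isSubringClosed.Build (R * S)%type amalg_pred amalg_subring_closed.

Definition amalg : Type := {x : R * S | amalg_pred x}.

HB.instance Definition _ := SubType.on amalg.
HB.instance Definition _ := [Choice of amalg by <:].
HB.instance Definition _ := [SubChoice_isSubComNzRing of amalg by <:].

Section AmalgIdeal.
Variable I : ideal R.

Definition amalg_ideal_set : set amalg := [set x | amalg_set I (val x)].

Lemma amalg_ideal0 : amalg_ideal_set 0.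
Proof.
by apply/amalg_setP; rewrite /= rmorph0 subr0; split; exact: ideal0.
Qed.

Lemma amalg_idealD x y :
  amalg_ideal_set x -> amalg_ideal_set y -> amalg_ideal_set (x + y).
Proof.
move=> /amalg_setP[Ix Jx] /amalg_setP[Iy Jy]; apply/amalg_setP.
rewrite raddfD /= rmorphD opprD addrACA.
by split; exact: idealD.
Qed.

Lemma amalg_idealM a x : amalg_ideal_set x -> amalg_ideal_set (a * x).
Proof.
have := valP a; rewrite /amalg_pred inE /= inE => /amalg_setP[_ Ja].
move=> /amalg_setP[Ix Jx]; apply/amalg_setP.
rewrite rmorphM /= rmorphM; split; first exact: idealM.
set a1 := (val a).1; set a2 := (val a).2.
set x1 := (val x).1; set x2 := (val x).2.
have -> : a2 * x2 - f a1 * f x1 = a2 * (x2 - f x1) + f x1 * (a2 - f a1) by ring.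
by apply: idealD; exact: idealM.
Qed.

Definition amalg_ideal : ideal amalg :=
  Ideal amalg_ideal0 amalg_idealD amalg_idealM.

End AmalgIdeal.
End Amalgamation.

(* Main.v *)
(** The Jacobson radical consists of the [a] such that every [1 - a x] is
    invertible.  The first projection is surjective from the amalgamation to R,
    and a tuple whose first entry [a] is outside J(R) is therefore outside the
    radical of the amalgamation.  If J is contained in J(S), then conversely
    [(a, f a + j)] is in the radical as soon as [a] is in J(R).
    So membership in the radical and in the ideal both depend on the first entry
    only, and the J-ideal condition transfers.  In the weak version the only
    difference is that a product may vanish in its first entry but not in the
    second, which is excluded by the condition on [f a * j + f b * i + i * j]. *)

Require Import Defs.
From mathcomp Require Import all_boot all_algebra.
From mathcomp Require Import ring.
From mathcomp Require Import boolp classical_sets.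

Import GRing.Theory.
Local Open Scope classical_set_scope.
Local Open Scope ring_scope.

(** * Maximal ideals and the unit criterion for the radical *)

Section Jacobson.
Variable A : comNzRingType.
Implicit Types (I M N : ideal A) (a c x y : A).

Lemma proper_idealP I : is_proper I <-> ~ I 1.
Proof.
split=> [Ip I1|I1 IT]; last by apply: I1; rewrite -[ideal_set I]/(I : set A) IT.
by apply: Ip; apply/seteqP; split=> // x _; rewrite -(mulr1 x); exact: idealM.
Qed.

(** The ideal I + (c), against which the maximality of I is tested. *)
Lemma ideal_adjoin I c :
  exists N, (N : set A) = [set y | exists2 m, I m & exists x, y = m + c * x].
Proof.
unshelve eexists (@Ideal A [set y | exists2 m, I m & exists x, y = m + c * x]
  _ _ _); last by [].
- by exists 0; [exact: ideal0 | exists 0; rewrite mulr0 addr0].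
- move=> _ _ [m Im [x ->]] [n In [y ->]].
  exists (m + n); first exact: idealD.
  by exists (x + y); ring.
- move=> a _ [m Im [x ->]]; exists (a * m); first exact: idealM.
  by exists (a * x); ring.
Qed.

(* Zorn's lemma is applied to the sets [X] such that [X `|` cA] is a proper
   ideal, so that the empty chain needs no separate treatment. *)
Lemma nonunit_maximal_ideal c :
  (forall y, c * y != 1) -> exists2 M, maximal_ideal M & M c.
Proof.
move=> cNunit.
pose E (X : set A) := X `|` range ( *%R c).
pose P (X : set A) := exists2 N, is_proper N & (N : set A) = E X.
have Ec X : E X c by right; exists 1; rewrite ?mulr1.
have P0 : P set0.
  unshelve eexists (@Ideal A (E set0) _ _ _).
  - by right; exists 0; rewrite ?mulr0.
  - move=> _ _ [//|[x _ <-]] [//|[y _ <-]].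
    by right; exists (x + y); rewrite ?mulrDr.
  - by move=> a _ [//|[x _ <-]]; right; exists (a * x); rewrite // mulrCA.
  - by apply/proper_idealP => -[//|[y _ /eqP]]; apply/negP; exact: cNunit.
  - by [].
have [|X [[M Mp ME] Xmax]] := @Zorn_bigcup A P.
  move=> F FP Ftot.
  (* With the empty set adjoined, the chain is never empty, so [E] of its union is the union of the
     ideals [E X] even when [F] is empty. *)
  pose G X := F X \/ X = set0.
  have GP X : G X -> P X by case=> [/FP//|->].
  have Gtot X Y : G X -> G Y -> X `<=` Y \/ Y `<=` X.
    move=> [FX|->]; last by left; exact: sub0set.
    by move=> [FY|->]; [exact: Ftot | right; exact: sub0set].
  have UP x : E (\bigcup_(X in F) X) x <-> exists2 X, G X & E X x.
    split=> [[[X FX Xx]|cx]|[X [FX|->] [Xx|cx]]] //; try by right.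
    - by exists X; left.
    - by exists set0; right.
    - by left; exists X.
  have ES X Y : X `<=` Y -> E X `<=` E Y by move=> XY; exact: setSU.
  unshelve eexists (@Ideal A (E (\bigcup_(X in F) X)) _ _ _).
  - by apply/UP; exists set0; [right | right; exists 0; rewrite ?mulr0].
  - move=> x y /UP[X GX Ex] /UP[Y GY Ey]; apply/UP.
    have [XY|YX] := Gtot _ _ GX GY.
    + exists Y => //; have [N _ NE] := GP _ GY; move: (ES _ _ XY _ Ex) Ey.
      by rewrite -NE; exact: idealD.
    + exists X => //; have [N _ NE] := GP _ GX; move: Ex (ES _ _ YX _ Ey).
      by rewrite -NE; exact: idealD.
  - move=> a x /UP[X GX Ex]; apply/UP; exists X => //.
    by have [N _ NE] := GP _ GX; move: Ex; rewrite -NE; exact: idealM.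
  - apply/proper_idealP => /UP[X GX]; have [N /proper_idealP N1 <-] := GP _ GX.
    exact: N1.
  - by [].
exists M; last by rewrite -[ideal_set M]/(M : set A) ME.
split=> // N Np MN; apply/seteqP; split=> //; apply: contrapT => NM.
have XN : X `<=` N by move=> x Xx; apply: MN; rewrite ME; left.
(* [N] itself contradicts the maximality of [X]: it contains the multiples of [c], so [E N] is
   [N]. *)
apply: (Xmax (N : set A)).
  by split=> // NX; apply: NM => x /NX Xx; rewrite ME; left.
exists N => //; apply/seteqP; split=> [x|x [//|cx]]; first by left.
by apply: MN; rewrite ME; right.
Qed.

(** A non-unit [1 - a * x] would lie in a maximal ideal together with [a], which forces 1 into it.
    Conversely, if 1 = m + a x with m in M, then M contains the unit 1 - a x; hence M + (a) is
    proper and equals M. *)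
Lemma jacobsonP a : jacobson A a <-> forall x, exists y, (1 - a * x) * y = 1.
Proof.
split=> [Ja x|aunit M [Mp Mmax]].
- apply: contrapT => noinv.
  have [y|M Mmax Mx] := @nonunit_maximal_ideal (1 - a * x).
    by apply/eqP => ?; apply: noinv; exists y.
  have /proper_idealP[] := Mmax.1.
  have -> : 1 = (1 - a * x) + x * a by ring.
  by apply: idealD => //; apply: idealM; exact: Ja.
- have [N NE] := ideal_adjoin M a.
  suff <- : (N : set A) = M.
    rewrite NE; exists 0; first exact: ideal0.
    by exists 1; rewrite add0r mulr1.
  apply: Mmax; last first.
    by rewrite NE => m Mm; exists m => //; exists 0; rewrite mulr0 addr0.
  apply/proper_idealP; rewrite -[ideal_set N]/(N : set A) NE => -[m Mm [x e]].
  have [y ey] := aunit x; have /proper_idealP[] := Mp.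
  by rewrite -ey e addrK mulrC; exact: idealM.
Qed.

End Jacobson.

(** * The radical of the amalgamation and the transfer of the two conditions *)

Section AmalgamationRadical.
Variables (R S : comNzRingType) (f : {rmorphism R -> S}) (J : ideal S).
Implicit Types (I : ideal R) (x y : amalg f J).

Lemma amalg_valM x y : val (x * y) = val x * val y. Proof. by []. Qed.

Lemma amalg_val_subr1 x : val (1 - x) = 1 - val x. Proof. by []. Qed.

Lemma amalg_eq x y :
  (val x).1 = (val y).1 -> (val x).2 = (val y).2 -> x = y.
Proof.
move=> e1 e2; apply: val_inj.
by rewrite [LHS]surjective_pairing e1 e2 -surjective_pairing.
Qed.

Lemma amalg_snd x : J ((val x).2 - f (val x).1).
Proof. by have := valP x; rewrite /amalg_pred inE /= inE => /amalg_setP[]. Qed.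

Lemma amalg_lift (r : R) (j : S) :
  J j -> {x : amalg f J | val x = (r, f r + j)}.
Proof.
move=> Jj; have rP : amalg_pred f J (r, f r + j).
  by rewrite /amalg_pred inE /= inE; exists r => //; exists j.
by exists (Sub (r, f r + j) rP); rewrite SubK.
Qed.

Lemma amalg_idealP I x : amalg_ideal f J I x <-> I (val x).1.
Proof.
split=> [/amalg_setP[]//|Ix]; apply/amalg_setP.
by split=> //; exact: amalg_snd.
Qed.

Lemma amalg_ideal_proper I : is_proper (amalg_ideal f J I) <-> is_proper I.
Proof. by rewrite !proper_idealP amalg_idealP. Qed.

(** Each [r] lifts to [(r, f r)], and the inverse found upstairs projects to an inverse in [R]. *)
Lemma jacobson_amalg_fst x : jacobson (amalg f J) x -> jacobson R (val x).1.
Proof.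
move=> /jacobsonP Jx; apply/jacobsonP => r.
have [z ez] := amalg_lift r 0 (ideal0 J).
have [y /(congr1 val)] := Jx z.
rewrite amalg_valM amalg_val_subr1 amalg_valM ez => /(congr1 fst) /= ey.
by exists (val y).1.
Qed.

Lemma jacobson_amalg x : (J : set S) `<=` jacobson S ->
  jacobson R (val x).1 -> jacobson (amalg f J) x.
Proof.
move=> JS /jacobsonP Jx; apply/jacobsonP => z.
have [u eu] := Jx (val z).1.
set r := 1 - (val x).1 * (val z).1 in eu.
have feu : f r * f u = 1 by rewrite -rmorphM eu rmorph1.
pose t := 1 - x * z.
have t1 : (val t).1 = r by rewrite /t amalg_val_subr1 amalg_valM.
have := amalg_snd t; rewrite t1; set k := _ - _ => Jk.
have t2 : (val t).2 = f r + k by rewrite /k; ring.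
(* [f r + k = f r * (1 + f u * k)] with [k] in J(S), and the inverse [f u * w]
   differs from [f u] by an element of J. *)
have /jacobsonP/(_ (- f u))[w ew] := JS _ Jk.
have ew' : (f r + k) * (f u * w) = 1.
  by rewrite -ew -[in RHS]feu; ring.
(* This element is [f u * w - f u], because [ew] gives w - 1 = - f u * k * w. *)
have Jw : J (- (f u * (f u * w)) * k) by exact: idealM.
have [y ey] := amalg_lift u _ Jw.
have y2 : (val y).2 = f u * w.
  by rewrite ey /= -[X in X + _]mulr1 -ew -[X in _ = X * w]mulr1; ring.
exists y; rewrite -/t; apply: amalg_eq.
- by rewrite -[LHS]/((val t).1 * (val y).1) t1 ey.
- by rewrite -[LHS]/((val t).2 * (val y).2) t2 y2.
Qed.

Lemma J_ideal_amalg_fst I : J_ideal (amalg_ideal f J I) -> J_ideal I.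
Proof.
move=> [/amalg_ideal_proper Ip aI]; split=> // a b Iab aJ.
have [x ex] := amalg_lift a 0 (ideal0 J).
have [y ey] := amalg_lift b 0 (ideal0 J).
suff: amalg_ideal f J I y by rewrite amalg_idealP ey.
apply: (aI x); first by apply/amalg_idealP; rewrite amalg_valM ex ey.
by move=> /jacobson_amalg_fst; rewrite ex.
Qed.

Lemma J_ideal_amalg I : (J : set S) `<=` jacobson S ->
  J_ideal I -> J_ideal (amalg_ideal f J I).
Proof.
move=> JS [Ip aI]; split=> [|x y]; first exact/amalg_ideal_proper.
rewrite !amalg_idealP amalg_valM => Ixy xJ; apply: aI Ixy _.
by move=> /(jacobson_amalg x JS).
Qed.

(** The lifts [(a, f a)] and [(b, f b)] have a nonzero product because its first entry [a * b] is
    nonzero. *)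
Lemma weakly_J_ideal_amalg_fst I :
  weakly_J_ideal (amalg_ideal f J I) -> weakly_J_ideal I.
Proof.
move=> [/amalg_ideal_proper Ip aI]; split=> // a b ab0 Iab aJ.
have [x ex] := amalg_lift a 0 (ideal0 J).
have [y ey] := amalg_lift b 0 (ideal0 J).
suff: amalg_ideal f J I y by rewrite amalg_idealP ey.
apply: (aI x); last 2 first.
- by apply/amalg_idealP; rewrite amalg_valM ex ey.
- by move=> /jacobson_amalg_fst; rewrite ex.
apply: contra_neq ab0 => /(congr1 val).
by rewrite amalg_valM ex ey => /(congr1 fst).
Qed.

(** As f(a) f(b) = 0, the expression is the second entry of the product of [(a, f a + i)] and
    [(b, f b + j)]. The first entry is 0, so a nonzero product would force [b] into [I]. *)
Lemma weakly_J_ideal_amalg_ann I : weakly_J_ideal (amalg_ideal f J I) ->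
  forall a b : R, a * b = 0 -> ~ jacobson R a -> ~ I b ->
  forall i j : S, J i -> J j -> f a * j + f b * i + i * j = 0.
Proof.
move=> [_ aI] a b ab0 aJ bI i j Ji Jj.
have [x ex] := amalg_lift a _ Ji.
have [y ey] := amalg_lift b _ Jj.
have -> : f a * j + f b * i + i * j = (val (x * y)).2.
  by rewrite amalg_valM ex ey /= -[LHS]add0r -(rmorph0 f) -ab0 rmorphM; ring.
have [->//|xy0] := eqVneq (x * y) 0.
case: bI; suff: amalg_ideal f J I y by rewrite amalg_idealP ey.
apply: (aI x) => //; last by move=> /jacobson_amalg_fst; rewrite ex.
by apply/amalg_idealP; rewrite amalg_valM ex ey /= ab0; exact: ideal0.
Qed.

Lemma weakly_J_ideal_amalg I : (J : set S) `<=` jacobson S ->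
  weakly_J_ideal I ->
  (forall a b : R, a * b = 0 -> ~ jacobson R a -> ~ I b ->
   forall i j : S, J i -> J j -> f a * j + f b * i + i * j = 0) ->
  weakly_J_ideal (amalg_ideal f J I).
Proof.
move=> JS [Ip aI] ann; split=> [|x y]; first exact/amalg_ideal_proper.
rewrite !amalg_idealP => xy0 Ixy xJ.
have x1J : ~ jacobson R (val x).1 by move=> /(jacobson_amalg x JS).
have [ab0|ab0] := eqVneq ((val x).1 * (val y).1) 0; last first.
  by apply: aI ab0 Ixy x1J.
apply: contrapT => y1I.
(* For i and j the offsets of [x] and [y] from the graph of [f], the expression is the product of
   the second entries minus f(a) f(b) = 0, so [x * y] vanishes in both entries. *)
have := ann _ _ ab0 x1J y1I _ _ (amalg_snd x) (amalg_snd y).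
have fab0 : f (val x).1 * f (val y).1 = 0 by rewrite -rmorphM ab0 rmorph0.
set xy2 := (X in X = 0).
have -> : xy2 = (val x).2 * (val y).2 - f (val x).1 * f (val y).1.
  by rewrite /xy2; ring.
rewrite fab0 subr0 => xy20; move/eqP: xy0; apply.
by apply: amalg_eq; rewrite amalg_valM.
Qed.

End AmalgamationRadical.

Theorem theorem6 (R S : comNzRingType) (f : {rmorphism R -> S})
    (J : ideal S) (I : ideal R) :
  ((J_ideal (amalg_ideal f J I) -> J_ideal I) /\
   ((J : set S) `<=` jacobson S ->
    J_ideal I -> J_ideal (amalg_ideal f J I))) /\
  ((weakly_J_ideal (amalg_ideal f J I) ->
    weakly_J_ideal I /\
    (forall a b : R, a * b = 0 -> ~ jacobson R a -> ~ I b ->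
     forall i j : S, J i -> J j -> f a * j + f b * i + i * j = 0)) /\
   ((J : set S) `<=` jacobson S ->
    weakly_J_ideal I /\
    (forall a b : R, a * b = 0 -> ~ jacobson R a -> ~ I b ->
     forall i j : S, J i -> J j -> f a * j + f b * i + i * j = 0) ->
    weakly_J_ideal (amalg_ideal f J I))).
Proof.
split; split.
- exact: J_ideal_amalg_fst.
- exact: J_ideal_amalg.
- move=> aI; split; first exact: weakly_J_ideal_amalg_fst aI.
  exact: weakly_J_ideal_amalg_ann aI.
- by move=> JS [aI ann]; exact: weakly_J_ideal_amalg.
Qed.
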